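(* Consider the constrained two-player zero-sum game with payoff matrix $Z$, transmitter strategy set $\mathbf{X}$ and jammer strategy set $\mathbf{Y}_{\mathrm{LE}|J_{\mathrm{ave}}}$. There exists a jammer threshold power $J_{\mathrm{TH}}$ with $0<J_{\mathrm{TH}}<J_{\max}$ such that, for every $J_{\mathrm{ave}}$ with $J_{\mathrm{TH}}\le J_{\mathrm{ave}}\le J_{\max}$, there exists $\boldsymbol{y}^*\in\mathbf{Y}_{\mathrm{LE}|J_{\mathrm{ave}}}$ for which, with $$\boldsymbol{x}^{*}=(0,\dots,0,1)^T\in\mathbf{X},$$ the pair $(\boldsymbol{x}^*,\boldsymbol{y}^* )$ is a Nash equilibrium of the game and the game value is $Z(\boldsymbol{x}^*,\boldsymbol{y}^* )=Z_{N_T}$.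
   Context: Let $N_T\ge 1$ be an integer. Jamming power levels: real numbers $0=J_0<J_1<\dots<J_{N_T}=J_{\max}$, collected in the column vector $\boldsymbol{J}=(J_0,\dots,J_{N_T})^T$. Payoffs: real numbers $Z_0>Z_1>\dots>Z_{N_T}>0$. The payoff matrix $Z$ is the $(N_T+1)\times(N_T+1)$ lower triangular matrix, indexed by $0\le i,j\le N_T$, with $(i,j)$ entry equal to $Z_i$ if $j\le i$ and $0$ if $j>i$ (the transmitter, using a strategy that withstands jamming power up to $J_i$, receives $Z_i$ if the actual jamming power $J_j$ satisfies $J_j\le J_i$, and $0$ otherwise). The row player (transmitter) maximizes and the column player (jammer) minimizes. $\mathbf{X}=\mathbf{Y}$ is the set of probability vectors in $\mathbb{R}^{N_T+1}$ (entries indexed by $0,\dots,N_T$). For $0\le J_{\mathrm{ave}}\le J_{\max}$, $\mathbf{Y}_{\mathrm{LE}|J_{\mathrm{ave}}}=\{\boldsymbol{y}\in\mathbf{Y}: \boldsymbol{y}^T\boldsymbol{J}\le J_{\mathrm{ave}}\}$. The expected payoff is $Z(\boldsymbol{x},\boldsymbol{y})=\boldsymbol{x}^TZ\boldsymbol{y}$. A Nash equilibrium is a pair $(\boldsymbol{x}^*,\boldsymbol{y}^* )\in\mathbf{X}\times\mathbf{Y}_{\mathrm{LE}|J_{\mathrm{ave}}}$ such that $Z(\boldsymbol{x},\boldsymbol{y}^* )\le Z(\boldsymbol{x}^*,\boldsymbol{y}^* )\le Z(\boldsymbol{x}^*,\boldsymbol{y})$ for all $\boldsymbol{x}\in\mathbf{X}$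 and $\boldsymbol{y}\in\mathbf{Y}_{\mathrm{LE}|J_{\mathrm{ave}}}$; $\boldsymbol{x}^*,\boldsymbol{y}^*$ are then called optimal mixed strategies and $Z(\boldsymbol{x}^*,\boldsymbol{y}^* )$ the game value. *)

(* Defs.v *)
From mathcomp Require Import all_boot all_order all_algebra.
From mathcomp Require Import reals.

Set Implicit Arguments.
Unset Strict Implicit.
Unset Printing Implicit Defensive.

Import Order.TTheory GRing.Theory Num.Theory.
Local Open Scope ring_scope.

Definition prob_vector (R : realType) (m : nat) (x : 'cV[R]_m) : Prop :=
  (forall i, 0 <= x i 0) /\ \sum_(i < m) x i 0 = 1.

(* Mixed strategies y over the power levels J whose average power y^T J is at
   most Jave. *)
Definition jammer_strategy (R : realType) (m : nat) (J : 'cV[R]_m) (Jave : R)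
    (y : 'cV[R]_m) : Prop :=
  prob_vector y /\ (y^T *m J) 0 0 <= Jave.

Definition payoff_mx (R : realType) (m : nat) (z : 'cV[R]_m) : 'M[R]_m :=
  \matrix_(i < m, j < m) (if (j <= i)%N then z i 0 else 0).

Definition expected_payoff (R : realType) (m : nat) (A : 'M[R]_m)
    (x y : 'cV[R]_m) : R :=
  (x^T *m A *m y) 0 0.

(* The row player, choosing x in X, maximizes; the column player minimizes. *)
Definition nash_equilibrium (R : realType) (m : nat) (A : 'M[R]_m)
    (X Y : 'cV[R]_m -> Prop) (xs ys : 'cV[R]_m) : Prop :=
  [/\ X xs, Y ys,
      forall x, X x -> expected_payoff A x ys <= expected_payoff A xs ys
    & forall y, Y y -> expected_payoff A xs ys <= expected_payoff A xs y].

(* Main.v *)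
Require Import Defs.
From mathcomp Require Import all_boot all_order all_algebra.
From mathcomp Require Import reals.

Import Order.TTheory GRing.Theory Num.Theory.
Local Open Scope ring_scope.

(** The jammer equalizes: he picks the distribution y* whose cumulative
    probabilities are Z_{N_T} / Z_i, so that Z y* is the constant vector
    Z_{N_T} and every transmitter strategy earns exactly Z_{N_T}.  Against x*
    every jammer strategy also yields exactly Z_{N_T}.  The threshold J_TH is
    the average power of y*: it is positive because y*_{N_T} > 0, and below
    J_max because y*_0 > 0 and J_0 = 0. *)

Section Payoff.
Context {R : realType} {n : nat}.
Implicit Types z x y : 'cV[R]_n.+1.

(** Since row [i] is constant on its support, [y] enters only through its cumulative mass;
    equalizing the rows therefore amounts to prescribing a cdf. *)
Lemma payoff_mx_mulE z y i :
  (payoff_mx z *m y) i 0 = z i 0 * \sum_(j < n.+1 | (j <= i)%N) y j 0.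
Proof.
rewrite mxE big_distrr [RHS]big_mkcond; apply: eq_bigr => j _ /=.
by rewrite mxE; case: ifP => // _; rewrite mul0r.
Qed.

(** The last row of the payoff matrix has no zero entry, so it only sees the total mass of [y]. *)
Lemma expected_payoff_ord_max z y : prob_vector y ->
  expected_payoff (payoff_mx z) (delta_mx ord_max 0) y = z ord_max 0.
Proof.
case=> _ y1; rewrite /expected_payoff -mulmxA trmx_delta -rowE mxE payoff_mx_mulE.
rewrite (eq_bigl xpredT) ?y1 ?mulr1 // => j.
by rewrite -ltnS ltn_ord.
Qed.

Lemma expected_payoff_const (A : 'M[R]_n.+1) x y c : prob_vector x ->
  A *m y = const_mx c -> expected_payoff A x y = c.
Proof.
case=> _ x1 Ay; rewrite /expected_payoff -mulmxA Ay mxE.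
rewrite (eq_bigr (fun i => x i 0 * c)) => [|i _]; last by rewrite !mxE.
by rewrite -mulr_suml x1 mul1r.
Qed.

(* [equalizer_cdf z k] is the mass strictly below level [k]. *)
Definition equalizer_cdf z (k : nat) : R :=
  if k is k'.+1 then z ord_max 0 / z (inord k') 0 else 0.

Definition equalizer z : 'cV[R]_n.+1 :=
  \col_i (equalizer_cdf z i.+1 - equalizer_cdf z i).

Lemma sum_equalizer z (i : 'I_n.+1) :
  \sum_(j < n.+1 | (j <= i)%N) equalizer z j 0 = z ord_max 0 / z i 0.
Proof.
pose F k := equalizer_cdf z k.+1 - equalizer_cdf z k.
rewrite (eq_bigr (fun j : 'I_n.+1 => F j)) => [|j _]; last by rewrite mxE.
(* [j <= i] converts to [j < i.+1], so the filtered sum becomes a telescoping sum over the naturals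
   below [i.+1]. *)
rewrite -(big_ord_widen n.+1 F (ltn_ord i)) -(big_mkord xpredT F).
by rewrite telescope_sumr // subr0 /= inord_val.
Qed.

Section DecreasingPayoffs.
Context {z : 'cV[R]_n.+1}.
Hypothesis z_decr : forall i j : 'I_n.+1, (i < j)%N -> z j 0 < z i 0.
Hypothesis z_max_gt0 : 0 < z ord_max 0.

Lemma decreasing_payoff_gt0 i : 0 < z i 0.
Proof.
have := leq_ord i; rewrite leq_eqVlt => /orP[/eqP ein|ltin].
  by rewrite (_ : i = ord_max) //; apply: val_inj.
exact: lt_trans z_max_gt0 (z_decr i ord_max ltin).
Qed.

(** The payoffs strictly decrease, so their inverses, and with them the cdf, strictly increase;
    level 0 carries the ratio of the last payoff to the first. *)
Lemma equalizer_gt0 i : 0 < equalizer z i 0.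
Proof.
rewrite mxE /= inord_val; case ei: (i : nat) => [|k] /=.
  by rewrite subr0 divr_gt0 ?decreasing_payoff_gt0.
rewrite subr_gt0 ltr_pM2l // ltf_pV2 ?posrE ?decreasing_payoff_gt0 //.
apply: z_decr; rewrite ei inordK //.
by apply: leq_trans (ltn_ord i); rewrite ei leqW.
Qed.

Lemma prob_vector_equalizer : prob_vector (equalizer z).
Proof.
split=> [i|]; first exact/ltW/equalizer_gt0.
(* The number 1 is the value of the cdf at [ord_max], where the sum runs over all levels. *)
rewrite -(divff (lt0r_neq0 z_max_gt0)) -sum_equalizer.
by apply: eq_bigl => j; rewrite -ltnS ltn_ord.
Qed.

Lemma payoff_mx_equalizer :
  payoff_mx z *m equalizer z = const_mx (z ord_max 0).
Proof.
apply/colP => i; rewrite payoff_mx_mulE sum_equalizer mxE mulrC divfK //.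
exact/lt0r_neq0/decreasing_payoff_gt0.
Qed.

End DecreasingPayoffs.
End Payoff.

Lemma mean_gt0 (R : realType) (m : nat) (y J : 'cV[R]_m) (k : 'I_m) :
  (forall i, 0 < y i 0) -> (forall i, 0 <= J i 0) -> 0 < J k 0 ->
  0 < (y^T *m J) 0 0.
Proof.
move=> y_gt0 J_ge0 Jk; rewrite mxE (bigD1 k) //= mxE ltr_pwDl ?mulr_gt0 //.
by apply: sumr_ge0 => i _; rewrite mxE mulr_ge0 ?J_ge0 ?ltW.
Qed.

(** Apply [mean_gt0] to the gap [b - J]; as [y] has mass 1, the constant [b] has mean [b]. *)
Lemma mean_lt (R : realType) (m : nat) (y J : 'cV[R]_m) (k : 'I_m) (b : R) :
  (forall i, 0 < y i 0) -> \sum_i y i 0 = 1 ->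
  (forall i, J i 0 <= b) -> J k 0 < b -> (y^T *m J) 0 0 < b.
Proof.
move=> y_gt0 y1 J_le Jk.
have mean_b : (y^T *m const_mx b : 'M_(1, 1)) 0 0 = b.
  rewrite mxE (eq_bigr (fun i => y i 0 * b)) => [|i _]; last by rewrite !mxE.
  by rewrite -mulr_suml y1 mul1r.
suff: 0 < (y^T *m (const_mx b - J)) 0 0.
  by rewrite mulmxBr mxE mean_b mxE subr_gt0.
apply: (mean_gt0 _ _ _ _ k) => // [i|]; first by rewrite !mxE subr_ge0.
by rewrite !mxE subr_gt0.
Qed.

Theorem theorem1 (R : realType) (n : nat) (hn : (1 <= n)%N)
    (J z : 'cV[R]_n.+1)
    (hJ0 : J ord0 0 = 0)
    (hJ : forall i j : 'I_n.+1, (i < j)%N -> J i 0 < J j 0)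
    (hz : forall i j : 'I_n.+1, (i < j)%N -> z j 0 < z i 0)
    (hz0 : 0 < z ord_max 0) :
  exists JTH : R,
    [/\ 0 < JTH, JTH < J ord_max 0
      & forall Jave : R, JTH <= Jave -> Jave <= J ord_max 0 ->
        let xs : 'cV[R]_n.+1 := delta_mx ord_max 0 in
        exists ys : 'cV[R]_n.+1,
          [/\ jammer_strategy J Jave ys,
              nash_equilibrium (payoff_mx z) (@prob_vector R n.+1)
                (jammer_strategy J Jave) xs ys
            & expected_payoff (payoff_mx z) xs ys = z ord_max 0]].
Proof.
have Jle (i j : 'I_n.+1) : (i <= j)%N -> J i 0 <= J j 0.
  by rewrite leq_eqVlt => /orP[/eqP/val_inj->|/hJ/ltW].
(* Here [hn] separates [ord0] from [ord_max]. *)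
have Jmax_gt0 : 0 < J ord_max 0 by rewrite -hJ0; apply: hJ.
have y_gt0 := equalizer_gt0 hz hz0.
have y_prob := prob_vector_equalizer hz hz0.
exists (((equalizer z)^T *m J) 0 0); split.
- by apply: (mean_gt0 _ _ _ _ _ y_gt0 _ Jmax_gt0) => i; rewrite -hJ0; apply: Jle.
- apply: (@mean_lt _ _ _ _ ord0) => //; first by case: y_prob.
    by move=> i; apply: Jle; apply: leq_ord.
  by rewrite hJ0.
move=> Jave JTH_le _ xs; exists (equalizer z).
have xs_payoff := expected_payoff_ord_max z.
split; [by [] | split=> // | exact: xs_payoff].
- split=> [i|]; first by rewrite mxE ler0n.
  rewrite (bigD1 ord_max) //= mxE !eqxx big1 ?addr0 // => i /negPf ne.
  by rewrite mxE ne.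
- move=> x x_prob; rewrite xs_payoff //.
  by rewrite (expected_payoff_const _ _ _ _ x_prob (payoff_mx_equalizer hz hz0)).
- by move=> y [y1_prob _]; rewrite !xs_payoff.
Qed.
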